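(* Let $N\geq 1$, let $\beta_N=(\sigma_1\sigma_2^{-1})^N\in B_3$, and let $K_N=\widehat{\beta_N}$ be its closure with the braid orientation. Let $\alpha\in B_3$. If the exponent sum of $\alpha$ satisfies $\operatorname{e}(\alpha)=0$ and the Jones polynomials satisfy $V_{\widehat\alpha}(t)=V_{K_N}(t)$, then $\alpha$ is conjugate to $\beta_N$ in $B_3$.
   Context: $B_3$ is the braid group on three strands with standard generators $\sigma_1,\sigma_2$. $\operatorname{e}(\alpha)$ is the exponent sum of $\alpha$, i.e. the image of $\alpha$ under the homomorphism $B_3\to\mathbb Z$ sending each $\sigma_i$ to $1$. The closure $\widehat\alpha$ is given its braid orientation (all strands oriented in parallel in the direction of the braid), with $\sigma_i$ giving a positive crossing. $V_L(t)$ is the Jones polynomial of the oriented link $L\subset S^3$, normalized so that the unknot has $V_{\bigcirc}(t)=1$; explicitly $V_L(t)=(-A)^{-3w(D)}\langle D\rangle$ with $t=A^{-4}$, where $\langle D\rangle$ is the Kauffman bracket (value $1$ on the crossingless unknot diagram) and $w(D)$ the writhe of a diagram $D$ of $L$. *)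

(* Defs.v *)
From HB Require Import structures.
From mathcomp Require Import all_boot all_order all_algebra fraction boolp.

Set Implicit Arguments.
Unset Strict Implicit.
Unset Printing Implicit Defensive.

Import GRing.Theory.
Local Open Scope quotient_scope.
Local Open Scope ring_scope.

(* A letter [(i, b)] with [i : 'I_2] is sigma_(i+1) if [b = true] and its
   inverse if [b = false]. *)
Definition letter : Type := ('I_2 * bool)%type.
Definition braid_word : Type := seq letter.

Definition letter1 : letter := (0, true).
Definition letter2 : letter := (1, true).

Definition letter_inv (x : letter) : letter := (x.1, ~~ x.2).
Definition word_inv (u : braid_word) : braid_word := rev (map letter_inv u).

Inductive braid_eq : braid_word -> braid_word -> Prop :=
| braid_eq_refl u : braid_eq u u
| braid_eq_sym u v : braid_eq u v -> braid_eq v u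
| braid_eq_trans u v w : braid_eq u v -> braid_eq v w -> braid_eq u w
| braid_eq_cat u u' v v' :
    braid_eq u u' -> braid_eq v v' -> braid_eq (u ++ v) (u' ++ v')
| braid_eq_cancel x : braid_eq [:: x; letter_inv x] [::]
| braid_eq_braid :
    braid_eq [:: letter1; letter2; letter1] [:: letter2; letter1; letter2].

Definition braid_rel (u v : braid_word) : bool := `[< braid_eq u v >].

Lemma braid_rel_refl : reflexive braid_rel.
Proof. by move=> u; apply/asboolP; apply: braid_eq_refl. Qed.

Lemma braid_rel_sym : symmetric braid_rel.
Proof. by move=> u v; apply: asbool_equiv_eq; split; apply: braid_eq_sym. Qed.

Lemma braid_rel_trans : transitive braid_rel.
Proof.
move=> v u w /asboolP uv /asboolP vw; apply/asboolP.
exact: braid_eq_trans uv vw.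
Qed.

Canonical braid_equiv :=
  EquivRel braid_rel braid_rel_refl braid_rel_sym braid_rel_trans.

Definition B3 : Type := {eq_quot braid_equiv}.
HB.instance Definition _ := Choice.on B3.
HB.instance Definition _ := EqQuotient.on B3.

Definition braid_of_word (u : braid_word) : B3 := \pi_B3 u.

Lemma braid_of_wordP u v :
  braid_of_word u = braid_of_word v <-> braid_eq u v.
Proof. by split=> [/eqmodP/asboolP | ?]; last exact/eqmodP/asboolP. Qed.

Lemma reprB3K (a : B3) : braid_of_word (repr a) = a.
Proof. exact: reprK. Qed.

Lemma word_invK : involutive word_inv.
Proof.
move=> u; rewrite /word_inv map_rev revK -map_comp map_id_in // => -[i b] _.
by rewrite /= /letter_inv /= negbK.
Qed.

Lemma word_inv_cat u v : word_inv (u ++ v) = word_inv v ++ word_inv u.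
Proof. by rewrite /word_inv map_cat rev_cat. Qed.

Lemma word_invP u : braid_eq (u ++ word_inv u) [::].
Proof.
elim: u => [|x u IHu]; first exact: braid_eq_refl.
have -> : (x :: u) ++ word_inv (x :: u)
  = [:: x] ++ ((u ++ word_inv u) ++ [:: letter_inv x]).
  by rewrite -cat1s word_inv_cat -!catA.
apply: braid_eq_trans (braid_eq_cancel x).
apply: (braid_eq_cat (braid_eq_refl [:: x])).
exact: braid_eq_cat IHu (braid_eq_refl [:: letter_inv x]).
Qed.

Lemma word_inv_eq u v : braid_eq u v -> braid_eq (word_inv u) (word_inv v).
Proof.
move=> uv; have vV := word_invP v.
have uV : braid_eq (word_inv u ++ u) [::].
  by have := word_invP (word_inv u); rewrite word_invK.
have := braid_eq_cat (braid_eq_refl (word_inv u)) (braid_eq_sym vV).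
rewrite cats0 => /braid_eq_trans; apply; rewrite catA.
apply: (braid_eq_cat (v' := word_inv v) (u' := [::])) (braid_eq_refl _).
apply: braid_eq_trans uV.
exact: braid_eq_cat (braid_eq_refl _) (braid_eq_sym uv).
Qed.

Definition B3_one : B3 := braid_of_word [::].
Definition B3_mul (a b : B3) : B3 := braid_of_word (repr a ++ repr b).
Definition B3_inv (a : B3) : B3 := braid_of_word (word_inv (repr a)).

Lemma B3_mulE u v :
  B3_mul (braid_of_word u) (braid_of_word v) = braid_of_word (u ++ v).
Proof.
by apply/braid_of_wordP; apply: braid_eq_cat;
  apply/braid_of_wordP; rewrite reprB3K.
Qed.

Lemma B3_invE u : B3_inv (braid_of_word u) = braid_of_word (word_inv u).
Proof.
by apply/braid_of_wordP/word_inv_eq/braid_of_wordP; rewrite reprB3K.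
Qed.

Lemma B3_mulA : associative B3_mul.
Proof.
move=> a b c; rewrite -[a]reprB3K -[b]reprB3K -[c]reprB3K.
by rewrite !B3_mulE catA.
Qed.

Lemma B3_mul1 : left_id B3_one B3_mul.
Proof. by move=> a; rewrite -[a]reprB3K B3_mulE. Qed.

Lemma B3_mulr1 : right_id B3_one B3_mul.
Proof. by move=> a; rewrite -[a]reprB3K B3_mulE cats0. Qed.

Lemma B3_mulV : right_inverse B3_one B3_inv B3_mul.
Proof.
move=> a; rewrite -[a]reprB3K B3_invE B3_mulE.
exact/braid_of_wordP/word_invP.
Qed.

Lemma B3_mulVl : left_inverse B3_one B3_inv B3_mul.
Proof.
move=> a; rewrite -[a]reprB3K B3_invE B3_mulE.
apply/braid_of_wordP; have := word_invP (word_inv (repr a)).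
by rewrite word_invK.
Qed.

HB.instance Definition _ :=
  isGroup.Build B3 B3_mulA B3_mul1 B3_mulr1 B3_mulVl B3_mulV.

Lemma braid_of_word_cat u v :
  braid_of_word (u ++ v) = (braid_of_word u * braid_of_word v)%g.
Proof. by rewrite -B3_mulE. Qed.

Definition sigma1 : B3 := braid_of_word [:: letter1].
Definition sigma2 : B3 := braid_of_word [:: letter2].

Definition word_expsum (u : braid_word) : int :=
  \sum_(x <- u) (if x.2 then 1 else - 1).

Definition expsum (a : B3) : int := word_expsum (repr a).

Lemma word_expsum_eq u v : braid_eq u v -> word_expsum u = word_expsum v.
Proof.
elim=> [//||u1 v1 w1 _ -> _ -> //|u1 u2 v1 v2 _ eu _ ev|[i b]|].
- by move=> u1 v1 _ ->.
- by move: eu ev; rewrite /word_expsum !big_cat /= => -> ->.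
- by rewrite /word_expsum !big_cons big_nil; case: b.
- by rewrite /word_expsum !big_cons.
Qed.

Lemma expsum_word u : expsum (braid_of_word u) = word_expsum u.
Proof. by apply/word_expsum_eq/braid_of_wordP; rewrite reprB3K. Qed.

Lemma expsumM : {morph expsum : a b / (a * b)%g >-> a + b}.
Proof.
move=> a b; rewrite -[a]reprB3K -[b]reprB3K -braid_of_word_cat !expsum_word.
by rewrite /word_expsum big_cat.
Qed.

Lemma expsum_sigma1 : expsum sigma1 = 1.
Proof. by rewrite expsum_word /word_expsum big_seq1. Qed.

Lemma expsum_sigma2 : expsum sigma2 = 1.
Proof. by rewrite expsum_word /word_expsum big_seq1. Qed.

(* The plane is turned locally so that both strands of a crossing point
   upwards; [bl], [br], [tl], [tr] are then its bottom left, bottom right, top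
   left and top right ends, so the strands run from [bl] to [tr] and from [br]
   to [tl].  The crossing is positive when the strand from [bl] to [tr] passes
   over the other one. *)
Record crossing (P : Type) := Crossing
  { bl : P; br : P; tl : P; tr : P; positive : bool }.

(* Points marked on a diagram, the crossings whose ends they are, and the pairs
   of points linked by a crossingless arc.  Only this combinatorial part of a
   planar diagram enters the Kauffman bracket. *)
Record diagram := Diagram
  { point : finType;
    crossings : seq (crossing point);
    arcs : seq (point * point) }.

(* Z[A, A^-1] is taken inside the fraction field of Z[A]. *)
Notation laurent := {fraction {poly int}}.

Definition varA : laurent := tofrac ('X : {poly int}).

Section Bracket.
Variable P : finType.
Implicit Types (c : crossing P) (s : seq (P * P)).

Definition vertical_smoothing c := [:: (bl c, tl c); (br c, tr c)].
Definition horizontal_smoothing c := [:: (bl c, br c); (tl c, tr c)].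

(* The A-smoothing merges the two regions swept by the over strand when it is
   turned counterclockwise: the top and bottom ones for a positive crossing,
   the left and right ones for a negative crossing. *)
Definition A_smoothing c :=
  if positive c then vertical_smoothing c else horizontal_smoothing c.
Definition B_smoothing c :=
  if positive c then horizontal_smoothing c else vertical_smoothing c.

Definition linked s : rel P := fun x y => ((x, y) \in s) || ((y, x) \in s).

Definition circles s : nat := n_comp (linked s) P.

Definition delta : laurent := - varA ^+ 2 - varA ^- 2.

Fixpoint bracket_rec (cs : seq (crossing P)) s : laurent :=
  if cs is c :: cs' then
    varA * bracket_rec cs' (A_smoothing c ++ s)
    + varA^-1 * bracket_rec cs' (B_smoothing c ++ s)
  else delta ^+ (circles s).-1.

End Bracket.

Definition bracket (D : diagram) : laurent :=
  bracket_rec (crossings D) (arcs D).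

Definition writhe (D : diagram) : int :=
  \sum_(c <- crossings D) (if positive c then 1 else - 1).

(* V(t) with t = A^(-4): as t |-> A^(-4) embeds Z[t^(1/2), t^(-1/2)] into
   Z[A, A^-1], equality of Jones polynomials is equality of these values. *)
Definition jones (D : diagram) : laurent :=
  (- varA) ^ (- 3%:Z * writhe D) * bracket D.

(* The point [(j, k)] is on the strand in position [j] at level [k].  The letter
   number [k] is placed between the levels [k] and [k+1], and the top level is
   linked to level [0]; all strands point upwards. *)
Section Closure.
Variable u : braid_word.
Let n := size u.
Let P : finType := ('I_3 * 'I_n.+1)%type.

Definition letter_at (k : 'I_n) : letter := tnth (in_tuple u) k.
Definition left_position (i : 'I_2) : 'I_3 := widen_ord (leqnSn 2) i.
Definition right_position (i : 'I_2) : 'I_3 := lift ord0 i.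
Definition level_below (k : 'I_n) : 'I_n.+1 := widen_ord (leqnSn n) k.
Definition level_above (k : 'I_n) : 'I_n.+1 := lift ord0 k.

Definition crossing_at (k : 'I_n) : crossing P :=
  let i := (letter_at k).1 in
  {| bl := (left_position i, level_below k);
     br := (right_position i, level_below k);
     tl := (left_position i, level_above k);
     tr := (right_position i, level_above k);
     positive := (letter_at k).2 |}.

Definition idle_arcs_at (k : 'I_n) : seq (P * P) :=
  let i := (letter_at k).1 in
  [seq ((j, level_below k), (j, level_above k)) |
     j <- enum 'I_3 & (j != left_position i) && (j != right_position i)].

Definition closing_arcs : seq (P * P) :=
  [seq ((j, ord_max), (j, ord0)) | j <- enum 'I_3].

Definition braid_closure : diagram :=
  {| point := P;
     crossings := [seq crossing_at k | k <- enum 'I_n];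
     arcs := flatten [seq idle_arcs_at k | k <- enum 'I_n] ++ closing_arcs |}.

End Closure.

Definition beta (N : nat) : B3 := ((sigma1 * sigma2^-1) ^+ N)%g.

Definition beta_word (N : nat) : braid_word :=
  flatten (nseq N [:: letter1; letter_inv letter2]).

Lemma beta_wordE N : braid_of_word (beta_word N) = beta N.
Proof.
rewrite /beta; elim: N => [|N IHN]; first by rewrite expg0.
rewrite expgS -IHN.
rewrite -[beta_word N.+1]/([:: letter1; letter_inv letter2] ++ beta_word N).
rewrite braid_of_word_cat; congr (_ * _)%g.
have -> : (sigma2^-1)%g = braid_of_word [:: letter_inv letter2].
  exact: B3_invE.
by rewrite -braid_of_word_cat.
Qed.

(* Main.v *)
(* Up to conjugation and powers of the full twist z = Delta^2, every 3-braid is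
   a positive word in a = sigma_1 and b = sigma_2^-1, or one of Delta,
   sigma_1 sigma_2, (sigma_1 sigma_2)^2; exponent sum 0 excludes the last three.
   The Kauffman bracket of the closure of a 3-braid of exponent sum 0 is
   d^2 - 2 plus the trace of the braid in the 2-dimensional representation rho
   of the Temperley-Lieb algebra, because a state made of e_(k_1), ..., e_(k_r)
   with r > 0 has 1 circle more than there are cyclically consecutive equal
   indices.  Up to a power of A and a sign, the trace of rho on z^k w is a
   polynomial 1 - s A^4 + ..., where s is the number of cyclic factors ab of w,
   and the exponent sum ties the power of A to the length of w alone.  So the
   Jones polynomial determines s and the length of w.  For beta_N these are N
   and 2N, attained only by the two rotations of (ab)^N, and then z^k = 1. *)
Require Import Defs.
From mathcomp Require Import all_boot all_order all_algebra.
From mathcomp Require Import fraction ring zify.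

Set Implicit Arguments.
Unset Strict Implicit.
Unset Printing Implicit Defensive.

Import GRing.Theory.

Lemma ord2P (P : 'I_2 -> Prop) : P 0%R -> P 1%R -> forall i, P i.
Proof.
by move=> P0 P1 [[|[|//]] lti2]; [move: P0|move: P1]; congr P; apply: val_inj.
Qed.

(** * Conjugacy classes of the amalgam *)

Section PositiveWords.
Local Open Scope group_scope.
Variable G : groupType.
Implicit Types (g h x y z a b c : G) (w : seq bool).

Definition eval_word a b w : G := \prod_(i <- w) (if i then a else b).

Lemma eval_nil a b : eval_word a b [::] = 1.
Proof. exact: big_nil. Qed.

Lemma eval_cons a b i w :
  eval_word a b (i :: w) = (if i then a else b) * eval_word a b w.
Proof. exact: big_cons. Qed.

Lemma eval_cat a b w1 w2 :
  eval_word a b (w1 ++ w2) = eval_word a b w1 * eval_word a b w2.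
Proof. exact: big_cat. Qed.

Lemma eval_rcons a b w i :
  eval_word a b (rcons w i) = eval_word a b w * (if i then a else b).
Proof. by rewrite -cats1 eval_cat eval_cons eval_nil mulg1. Qed.

Definition conjugate g h := exists k, h = g ^ k.

Lemma conjugate_refl g : conjugate g g.
Proof. by exists 1; rewrite conjg1. Qed.

Lemma conjugate_trans h g k : conjugate g h -> conjugate h k -> conjugate g k.
Proof. by move=> [u ->] [v ->]; exists (u * v); rewrite conjgM. Qed.

Lemma conjugate_mulC g h : conjugate (g * h) (h * g).
Proof. by exists g; rewrite conjgE -mulgA mulKg. Qed.

Definition zpower z c := exists i j, c = z ^+ i / z ^+ j.

Lemma zpower1 z : zpower z 1.
Proof. by exists 0%N, 0%N; rewrite expg0 divg1. Qed.

Lemma zpowerM z c : zpower z c -> zpower z (z * c).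
Proof. by move=> [i [j ->]]; exists i.+1, j; rewrite expgS mulgA. Qed.

Lemma zpowerV z c : zpower z c -> zpower z (z^-1 * c).
Proof.
move=> [i [j ->]]; exists i, j.+1; rewrite expgSr invgM !mulgA.
congr (_ * _); apply: commute_sym; apply: commuteV; exact/commute_sym/commuteX.
Qed.

End PositiveWords.

(* [B_3] is the amalgam [<x, y | x^2 = y^3>], with [x] the half twist,
   [y = sigma_1 sigma_2] and [a], [b] the letters [sigma_1], [sigma_2^-1]. *)
Section Amalgam.
Local Open Scope group_scope.
Variables (G : groupType) (x y : G).
Implicit Types (g h k c : G) (w : seq bool).
Hypothesis xxyyy : x * x = y * y * y.
Let z := x * x.
Let a := y^-1 * x.
Let b := y * x^-1.

Let zx : commute z x. Proof. by rewrite /commute mulgA. Qed.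
Let zy : commute z y. Proof. by rewrite /commute /z xxyyy !mulgA. Qed.
Let zb : commute z b.
Proof. by apply: commuteM => //; apply: commuteV. Qed.

(** Beside [x] or [y], a letter is absorbed or changed into the other one, and [y * x] is a letter
    up to the central [z]. *)
Let ya : y * a = x. Proof. by rewrite mulVKg. Qed.
Let yyE : y * y = y^-1 * z.
Proof. by rewrite /z xxyyy -(mulgA y y y) mulKg. Qed.
Let yb : y * b = a.
Proof. by rewrite /b /a mulgA yyE -mulgA /z mulgK. Qed.
Let ax : a * x = y * y. Proof. by rewrite yyE /a -mulgA. Qed.
Let bx : b * x = y. Proof. by rewrite /b mulgVK. Qed.
Let yx : y * x = z * b.
Proof. by rewrite zb /b /z -mulgA mulKg. Qed.

(* Either conjugate to a positive word in [a] and [b], or of finite order modulo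
   the powers of [z]. *)
Definition reduced g := exists c w,
  zpower z c /\ (conjugate (c * eval_word a b w) g \/
  conjugate (c * x) g \/ conjugate (c * y) g \/ conjugate (c * (y * y)) g).

Let reduced_conj g h : conjugate g h -> reduced g -> reduced h.
Proof.
move=> gh [c [w [cz r]]]; exists c, w; split=> //.
case: r => [|[|[|]]] r; [left|right;left|do 2!right;left|do 3!right];
  exact: conjugate_trans gh.
Qed.

Let conjugate_center c g h :
  (forall k, commute c k) -> conjugate g h -> conjugate (c * g) (c * h).
Proof.
move=> cC [k ->]; exists k; rewrite conjMg; congr (_ * _).
by rewrite conjgE cC mulKg.
Qed.

Hypothesis zC : forall g, commute z g.

Let reducedZ g : reduced g -> reduced (z * g).
Proof.
move=> [c [w [cz r]]]; exists (z * c), w; split; first exact: zpowerM.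
case: r => [|[|[|]]] r; [left|right;left|do 2!right;left|do 3!right];
  by rewrite -mulgA; apply: conjugate_center.
Qed.

Let reducedV g : reduced g -> reduced (z^-1 * g).
Proof.
move=> [c [w [cz r]]]; exists (z^-1 * c), w; split; first exact: zpowerV.
case: r => [|[|[|]]] r; [left|right;left|do 2!right;left|do 3!right];
  rewrite -mulgA; apply: conjugate_center r => k;
  exact/commute_sym/commuteV/commute_sym/zC.
Qed.

Let reduced_word w : reduced (eval_word a b w).
Proof.
exists 1, w; split; first exact: zpower1.
by left; rewrite mul1g; apply: conjugate_refl.
Qed.

(** Induction on the length, for the three tails at once. A final [x] absorbs the last letter and
    becomes a power of [y]. A power of [y] is rotated to the front, where it either changes the
    first letter, leaving a positive word, or absorbs it and becomes [x], the tail of a shorter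
    word. *)
Let reduced_tail n w : (size w <= n)%N ->
  [/\ reduced (eval_word a b w * x), reduced (eval_word a b w * y)
    & reduced (eval_word a b w * (y * y))].
Proof.
have IH0 : [/\ reduced (eval_word a b [::] * x),
    reduced (eval_word a b [::] * y) & reduced (eval_word a b [::] * (y * y))].
  rewrite eval_nil !mul1g.
  by split; exists 1, [::]; split; rewrite ?mul1g; first [exact: zpower1 |
   right; auto using conjugate_refl].
elim: n w => [|n IHn] w sw.
  by move: sw; rewrite leqn0 => /nilP ->.
split.
- case/lastP: w => [|w j] in sw *; first by case: IH0.
  rewrite size_rcons in sw; have [_ IHy IHyy] := IHn w sw.
  by rewrite eval_rcons -mulgA; case: j sw => sw; rewrite ?ax ?bx.
- case: w => [|i w] in sw *; first by case: IH0.
  apply: (reduced_conj (conjugate_mulC _ _)); rewrite eval_cons mulgA.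
  case: i sw => sw.
    rewrite ya; apply: (reduced_conj (conjugate_mulC _ _)).
    by have [] := IHn w sw.
  by rewrite yb -(eval_cons a b true); apply: reduced_word.
- case: w => [|i w] in sw *; first by case: IH0.
  apply: (reduced_conj (conjugate_mulC _ _)); rewrite eval_cons mulgA.
  case: i sw => sw; rewrite -(mulgA y y) ?ya ?yb ?yx.
    by rewrite -mulgA -(eval_cons a b false); apply/reducedZ/reduced_word.
  rewrite ya; apply: (reduced_conj (conjugate_mulC _ _)).
  by have [] := IHn w sw.
Qed.

(** As [y ^+ 3] is the central [z], the exponents 0, 1, 2 suffice; before [x], [y * x = z * b] and
    [y * y * x = z * a] extend the word. *)
Let reduced_suffix q w :
  reduced (eval_word a b w * y ^+ q) /\ reduced (eval_word a b w * y ^+ q * x).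
Proof.
have [rx ry ryy] := reduced_tail (leqnn (size w)).
elim/ltn_ind: q => -[|[|[|q]]] IHq.
- by rewrite expg0 mulg1.
- rewrite expg1 -mulgA yx (mulgA _ z b) -(zC (eval_word a b w)) -mulgA.
  split=> //.
  by rewrite -(eval_rcons a b w false); apply/reducedZ/reduced_word.
- rewrite expg2 -(mulgA _ (y * y) x) -(mulgA y y x) yx (mulgA y z b) -zy.
  rewrite -(mulgA z y b) yb (mulgA _ z a) -(zC (eval_word a b w)) -mulgA.
  split=> //.
  by rewrite -(eval_rcons a b w true); apply/reducedZ/reduced_word.
have -> : y ^+ q.+3 = z * y ^+ q by rewrite !expgS !mulgA -xxyyy.
rewrite (mulgA _ z) -(zC (eval_word a b w)) -!(mulgA z) -[_ * _ * x]mulgA.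
have [|r rx'] := IHq q; first by rewrite ltnS leqW.
by split; apply: reducedZ; rewrite ?mulgA.
Qed.

Let reduced_zpower c g : zpower z c -> reduced g -> reduced (c * g).
Proof.
move=> [i [j ->]] rg; rewrite -mulgA.
have {rg}: reduced ((z ^+ j)^-1 * g).
  rewrite -expVgn; elim: j => [|j IHj]; first by rewrite expg0 mul1g.
  by rewrite expgS -mulgA; apply: reducedV.
elim: i => [|i IHi] rg; first by rewrite expg0 mul1g.
by rewrite expgS -mulgA; apply/reducedZ/IHi.
Qed.

Let zpowerC c g : zpower z c -> commute c g.
Proof.
move=> [i [j ->]]; apply: commute_sym; apply: commuteM; last apply: commuteV;
  exact/commuteX/commute_sym.
Qed.

(** A shape stable under left multiplication by [x], [y] and their inverses, hence shared by
    everything they generate. *)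
Definition normal g := exists c p w q,
  zpower z c /\ g = c * (x ^+ nat_of_bool p * (eval_word a b w * y ^+ q)).

Lemma normal1 : normal 1.
Proof.
exists 1, false, [::], 0%N; split; first exact: zpower1.
by rewrite eval_nil !expg0 !mul1g.
Qed.

Lemma normal_reduced g : normal g -> reduced g.
Proof.
move=> [c [p [w [q [cz ->]]]]]; apply: reduced_zpower cz _.
have [r rx] := reduced_suffix q w.
case: p; rewrite ?expg1 ?expg0 ?mul1g //.
exact: (reduced_conj (conjugate_mulC _ _)).
Qed.

Lemma normal_mulx g : normal g -> normal (x * g).
Proof.
move=> [c [p [w [q [cz ->]]]]]; rewrite mulgA -(zpowerC _ cz) -(mulgA c).
case: p; rewrite ?expg1 ?expg0 ?mul1g.
  exists (z * c), false, w, q; split; first exact: zpowerM.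
  by rewrite mul1g (mulgA x x) mulgA -(zC c).
by exists c, true, w, q.
Qed.

(** The new [y] meets [x], giving [z * b], or the letter [a], giving [x], or the letter [b], giving
    [a], or joins the final power of [y]. *)
Lemma normal_muly g : normal g -> normal (y * g).
Proof.
move=> [c [p [w [q [cz ->]]]]]; rewrite mulgA -(zpowerC _ cz) -(mulgA c).
case: p; rewrite ?expg1 ?expg0 ?mul1g.
  exists (z * c), false, (false :: w), q; split; first exact: zpowerM.
  by rewrite (mulgA y) yx expg0 mul1g eval_cons (zC c) -!mulgA.
case: w => [|[] w].
- exists c, false, [::], q.+1; split=> //.
  by rewrite expg0 eval_nil !mul1g -expgS.
- by exists c, true, w, q; rewrite eval_cons expg1 -(mulgA a) (mulgA y a) ya.
- exists c, false, (true :: w), q; split=> //.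
  by rewrite !eval_cons expg0 mul1g -(mulgA b) (mulgA y b) yb -(mulgA a).
Qed.

Lemma normalV g : normal g -> normal (z^-1 * g).
Proof.
move=> [c [p [w [q [cz ->]]]]]; exists (z^-1 * c), p, w, q.
by split; [exact: zpowerV|rewrite mulgA].
Qed.

Lemma normal_mulVx g : normal g -> normal (x^-1 * g).
Proof.
move=> /normal_mulx/normalV; congr normal.
by rewrite mulgA; congr (_ * _); rewrite /z invgM mulgVK.
Qed.

Lemma normal_mulVy g : normal g -> normal (y^-1 * g).
Proof.
move=> /normal_muly/normal_muly/normalV; congr normal.
rewrite !mulgA; congr (_ * _); rewrite /z xxyyy -mulgA invgM mulgVK //.
Qed.

End Amalgam.

(** * Counting circles by 2-colourings *)

Section Colourings.
Variable P : finType.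
Implicit Types (s : seq (P * P)) (f : {ffun P -> bool}).

Definition colouring s f := all (fun p => f p.1 == f p.2) s.

Lemma colouring_connect s f x y :
  colouring s f -> connect (linked s) x y -> f x = f y.
Proof.
move/allP=> sf; apply: (@closed_connect _ _ f) => {}x {}y.
by case/orP=> /sf /= /eqP fxy; rewrite -![_ \in _]/(f _) fxy.
Qed.

(** A colouring is constant on each circle, hence determined by the set of roots coloured [true].
    Colourings, unlike components, can be counted level by level. *)
Lemma card_colouring s : #|[set f | colouring s f]| = (2 ^ circles s)%N.
Proof.
have sym: connect_sym (linked s).
  by apply: sym_connect_sym => x y; rewrite /linked orbC.
pose R := [set x | roots (linked s) x].
pose ext (B : {set P}) : {ffun P -> bool} :=
  [ffun x => fingraph.root (linked s) x \in B].
have -> : [set f | colouring s f] = ext @: powerset R.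
  apply/setP=> f; rewrite inE; apply/idP/imsetP => [sf|[B _ ->]].
    exists [set x in R | f x].
      by rewrite inE; apply/subsetP=> x; rewrite inE => /andP[].
    apply/ffunP=> x; rewrite ffunE !inE roots_root //=.
    exact: colouring_connect sf (connect_root _ _).
  apply/allP=> -[x y] sxy /=; rewrite !ffunE.
  suff /(fingraph.rootP sym) -> : connect (linked s) x y by [].
  by apply: connect1; rewrite /linked sxy.
rewrite card_in_imset.
  rewrite card_powerset /circles /n_comp_mem; congr (2 ^ _)%N.
  by apply: eq_card => x; rewrite !inE andbT.
move=> B C; rewrite !inE => /subsetP sBR /subsetP sCR /ffunP eBC.
apply/setP=> x; have := eBC x; rewrite !ffunE.
case: (boolP (x \in R)) => [|xR _].
  by rewrite inE => /eqP ->.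
by rewrite (contraNF (sBR x) xR) (contraNF (sCR x) xR).
Qed.

End Colourings.

(** * Transfer matrices of Temperley-Lieb diagrams *)

Lemma big_tuple_cons (R : Type) (idx : R) (op : Monoid.com_law idx)
    (T : finType) n (F : n.+1.-tuple T -> R) :
  \big[op/idx]_(t : n.+1.-tuple T) F t =
  \big[op/idx]_x \big[op/idx]_(t : n.-tuple T) F [tuple of x :: t].
Proof.
rewrite pair_bigA.
rewrite (reindex (fun p : T * n.-tuple T => [tuple of p.1 :: p.2])) //=.
exists (fun t : n.+1.-tuple T => (thead t, [tuple of behead t])).
  move=> [x t] _.
  by congr (_, _); apply: val_inj.
by move=> t _; rewrite [RHS]tuple_eta; apply: val_inj.
Qed.

(* The colours of the three strands at a given level of a closed braid. *)
Definition level := (bool * bool * bool)%type.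

Definition strand (x : level) (j : 'I_3) : bool :=
  nth false [:: x.1.1; x.1.2; x.2] j.

Definition capped (i : 'I_2) (x : level) :=
  if i == ord0 then x.1.1 == x.1.2 else x.1.2 == x.2.

Definition uncapped (i : 'I_2) (x : level) := if i == ord0 then x.2 else x.1.1.

(* The colourings of the boundary that extend to the product of Temperley-Lieb
   generators [e_i ... e_j]. *)
Definition transfer2 (i j : 'I_2) (x y : level) :=
  [&& capped i x, capped j y & uncapped i x == uncapped j y].

Definition transfer (o : option 'I_2) (x y : level) : bool :=
  if o is Some i then transfer2 i i x y else x == y.

Fixpoint transfer_path (os : seq (option 'I_2)) (x : level) (p : seq level) :=
  match os, p with
  | o :: os', y :: p' => transfer o x y && transfer_path os' y p'
  | _, _ => true
  end.

Fixpoint paths (os : seq (option 'I_2)) (x y : level) : nat :=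
  if os is o :: os' then \sum_(z : level) transfer o x z * paths os' z y
  else x == y.

Lemma card_paths os x y :
  \sum_(p : (size os).-tuple level) (transfer_path os x p && (last x p == y))
  = paths os x y.
Proof.
elim: os x => [|o os IHos] x /=.
  rewrite (big_pred1 [tuple]) //= => p; exact/esym/eqP/tuple0.
rewrite big_tuple_cons; apply: eq_bigr => z _ /=.
by rewrite -IHos big_distrr; apply: eq_bigr => p _; rewrite /= -andbA mulnb.
Qed.

Fixpoint stays (i : 'I_2) (v : seq 'I_2) : nat :=
  if v is j :: v' then (i == j) + stays j v' else 0.

Lemma sum_level (F : level -> nat) :
  \sum_x F x = \sum_(a : bool) \sum_(b : bool) \sum_(c : bool) F (a, b, c).
Proof.
rewrite pair_bigA /= pair_bigA /=.
by apply: eq_bigr => -[[a b] c].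
Qed.

(** Equal turnbacks in the middle close a circle, which has two colours; different ones join the
    strands into one, whose colour is forced. *)
Lemma transfer2_comp i j k l x y :
  \sum_z transfer2 i j x z * transfer2 k l z y
  = 2 ^ (j == k) * transfer2 i l x y.
Proof.
rewrite sum_level !big_bool /transfer2.
case: (capped i x) => //=; case: (capped l y); rewrite ?(andbF, muln0) //=.
move: (uncapped i x) (uncapped l y) => b c.
by elim/ord2P: j; elim/ord2P: k; case: b; case: c.
Qed.

Lemma sum_transfer2 i j : \sum_x transfer2 i j x x = 2 ^ (i == j).+1.
Proof.
by rewrite sum_level !big_bool; elim/ord2P: i; elim/ord2P: j.
Qed.

Lemma paths_None os x y : paths (None :: os) x y = paths os x y.
Proof.
rewrite /= (bigD1 x) //= eqxx mul1n big1 ?addn0 // => z /negPf.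
by rewrite eq_sym => ->.
Qed.

Lemma paths_transfer2 i j os x y :
  \sum_z transfer2 i j x z * paths os z y =
  2 ^ stays j (pmap id os) * transfer2 i (last j (pmap id os)) x y.
Proof.
elim: os j => [|[k|] os IHos] j.
- rewrite mul1n (bigD1 y) //= eqxx muln1 big1 ?addn0 // => z /negPf ->.
  by rewrite muln0.
- rewrite /=; under eq_bigr do rewrite big_distrr /=.
  rewrite exchange_big /= expnD -mulnA -IHos big_distrr /=.
  apply: eq_bigr => t _; rewrite mulnA -transfer2_comp big_distrl.
  by apply: eq_bigr => z _; rewrite mulnA.
- by under eq_bigr do rewrite paths_None; rewrite IHos.
Qed.

(** Closing up compares the last turnback with the first and adds one further circle; without
    turnbacks the three strands close separately. *)
Lemma paths_closed os :
  \sum_x paths os x x =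
  2 ^ (if pmap id os is i :: v then (stays i v + (last i v == i)).+1 else 3).
Proof.
elim: os => [|[i|] os IHos].
- by rewrite sum_level !big_bool.
- rewrite (eq_bigr _ (fun x _ => paths_transfer2 i i os x x)).
  by rewrite -big_distrr /= sum_transfer2 -expnD addnS eq_sym.
- by under eq_bigr do rewrite paths_None.
Qed.

(** * Circles in the smoothings of a closed braid *)

Section SmoothedClosure.
Variable u : braid_word.
Let n := size u.
Local Notation P := ('I_3 * 'I_n.+1)%type.

Definition smoothing (kh : 'I_n * bool) : seq (P * P) :=
  if kh.2 then horizontal_smoothing (crossing_at kh.1)
  else vertical_smoothing (crossing_at kh.1).

Definition turnback (kh : 'I_n * bool) : option 'I_2 :=
  if kh.2 then Some (letter_at kh.1).1 else None.

(** Level 0 carries [x] and level [k + 1] the entry [k] of [p]; the default of [nth] is never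
    reached. *)
Definition colouring_of (x : level) (p : n.-tuple level) : {ffun P -> bool} :=
  [ffun jk : P => strand (nth x (x :: p) jk.2) jk.1].

Lemma strandP (x y : level) : (forall j, strand x j = strand y j) -> x = y.
Proof.
move: x y => [[a b] c] [[a' b'] c'] e.
have := e 0%R; have := e 1%R; have := e (inord 2).
by rewrite /strand inordK //= => -> -> ->.
Qed.

Lemma colouring_of_inj : injective (fun xp => colouring_of xp.1 xp.2).
Proof.
move=> [x p] [y q] /= /ffunP e.
have {}e k : (k <= n)%N -> nth x (x :: p) k = nth y (y :: q) k.
  rewrite -ltnS => ltkn; apply: strandP => j.
  by have := e (j, Ordinal ltkn); rewrite !ffunE.
have exy : x = y := e 0%N isT; rewrite {}exy in e *; congr (_, _).
apply: eq_from_tnth => k; rewrite !(tnth_nth y).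
exact: e k.+1 (ltn_ord k).
Qed.

Lemma colouring_of_surj f : exists xp, f = colouring_of xp.1 xp.2.
Proof.
pose row k : level := (f (0%R, k), f (1%R, k), f (inord 2, k)).
exists (row ord0, [tuple row (lift ord0 k) | k < n]) => /=.
apply/ffunP=> -[j k]; rewrite ffunE /=.
have -> : nth (row ord0)
    (row ord0 :: [seq row (lift ord0 i) | i <- enum 'I_n]) k = row k.
  rewrite (map_comp row (lift ord0)) -[_ :: _]/(map row (ord0 :: _)).
  rewrite -enum_ordSl.
  by rewrite (nth_map ord0) ?size_enum_ord // nth_ord_enum.
rewrite /strand; case: j => -[|[|[|//]]] ltj /=; congr (f (_, _));
  apply: val_inj => //=.
by rewrite inordK.
Qed.

Lemma colouring_flatten (T : eqType) (F : T -> seq (P * P)) (ks : seq T) f :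
  colouring (flatten [seq F k | k <- ks]) f
  = all (fun k => colouring (F k) f) ks.
Proof. by elim: ks => //= k ks <-; rewrite /colouring all_cat. Qed.

Lemma enum3E : enum 'I_3 = [:: 0%R; 1%R; inord 2].
Proof.
by apply: (inj_map val_inj); rewrite val_enum_ord /= inordK.
Qed.

Lemma eq_level (x y : level) :
  all (fun j => strand x j == strand y j) (enum 'I_3) = (x == y).
Proof.
apply/allP/eqP => [e|-> //]; apply: strandP => j; apply/eqP/e.
exact: mem_enum.
Qed.

(** Together with the idle strand, a vertical smoothing is the identity diagram and a horizontal one
    is [e_i]; the boundary colours are checked exhaustively. *)
Lemma colouring_local (k : 'I_n) h x p (f := colouring_of x p)
    (y := nth x (x :: p) k) (z := nth x p k) :
  colouring (smoothing (k, h)) f && colouring (idle_arcs_at k) f =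
  transfer (turnback (k, h)) y z.
Proof.
have fE j l : f (j, l) = strand (nth x (x :: p) l) j by rewrite ffunE.
rewrite /colouring /idle_arcs_at all_map all_filter enum3E /smoothing /turnback.
rewrite /horizontal_smoothing /vertical_smoothing /crossing_at.
move: (letter_at k).1 => i.
case: h => /=; rewrite !fE /= /strand -?[nth x p k]/z -?/y;
  elim/ord2P: i; rewrite /= -!val_eqE /= ?inordK //=;
  by move: y z => [[[] []] []] [[[] []] []].
Qed.

Lemma transfer_pathE x (os : seq (option 'I_2)) p : size p = size os ->
  transfer_path os x p =
  all (fun k => transfer (nth None os k) (nth x (x :: p) k) (nth x p k))
    (iota 0 (size os)).
Proof.
elim: os x p => [|o os IHos] x [|y p] //= [sp].
rewrite IHos // -[1%N]/(1 + 0)%N iotaDl all_map; congr (_ && _).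
apply/eq_in_all => k; rewrite mem_iota /= => ltk.
by congr (transfer _ _ _); apply: set_nth_default; rewrite /= sp // ltnW.
Qed.

(** The smoothings come in reverse because [bracket_rec] puts each new one in front. The condition
    on [last] comes from the closing arcs. *)
Lemma colouring_closure (h : 'I_n -> bool) x (p : n.-tuple level)
    (os := [seq turnback (k, h k) | k <- enum 'I_n]) :
  colouring (flatten [seq smoothing (k, h k) | k <- rev (enum 'I_n)]
    ++ arcs (braid_closure u)) (colouring_of x p)
  = transfer_path os x p && (last x p == x).
Proof.
have szos : size os = n by rewrite size_map size_enum_ord.
rewrite transfer_pathE ?szos ?(size_tuple p) //.
rewrite /colouring !all_cat -!/(colouring _ _) !colouring_flatten andbA.
rewrite all_rev -all_predI; congr (_ && _).
  rewrite -val_enum_ord all_map; apply: eq_all => k /=.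
  by rewrite colouring_local (nth_map k) ?size_enum_ord // nth_ord_enum.
rewrite /colouring all_map -(eq_level (last x p)); apply: eq_all => j /=.
rewrite !ffunE /=; congr (strand _ _ == _).
by rewrite (last_nth x) (size_tuple p).
Qed.

(** Both sides are compared as exponents of 2: the colourings are counted by circles and by paths
    through the levels. *)
Lemma circles_closure (h : 'I_n -> bool) :
  circles (flatten [seq smoothing (k, h k) | k <- rev (enum 'I_n)]
    ++ arcs (braid_closure u)) =
  if pmap id [seq turnback (k, h k) | k <- enum 'I_n] is i :: v
  then (stays i v + (last i v == i)).+1 else 3.
Proof.
apply: (@expnI 2) => //; rewrite -card_colouring -paths_closed.
set os := [seq turnback (k, h k) | k <- enum 'I_n].
have szos : n = size os by rewrite size_map size_enum_ord.
under [RHS]eq_bigr do rewrite -card_paths.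
rewrite -szos pair_bigA /=.
pose closed (xp : level * n.-tuple level) :=
  transfer_path os xp.1 xp.2 && (last xp.1 xp.2 == xp.1).
have -> : [set f | colouring (flatten [seq smoothing (k, h k)
    | k <- rev (enum 'I_n)] ++ arcs (braid_closure u)) f]
  = (fun xp => colouring_of xp.1 xp.2) @: [set xp | closed xp].
  apply/setP=> f; rewrite inE; apply/idP/imsetP => [|[xp]].
    by have [xp ->] := colouring_of_surj f => cf; exists xp;
      rewrite // inE /closed -colouring_closure.
  by rewrite inE /closed -colouring_closure => ? ->.
rewrite card_imset; last exact: colouring_of_inj.
rewrite -sum1dep_card big_mkcond; apply: eq_bigr => xp _.
by rewrite -/(closed xp); case: closed.
Qed.

End SmoothedClosure.

Local Open Scope ring_scope.

(** * The Temperley-Lieb representation *)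

Section Matrix22.
Variable R : nzRingType.
Implicit Types a b c d : R.

Definition mx22 a b c d : 'M[R]_2 :=
  \matrix_(i, j) if i == 0 then (if j == 0 then a else b)
                 else (if j == 0 then c else d).

Lemma mx22P (M N : 'M[R]_2) :
  M 0 0 = N 0 0 -> M 0 1 = N 0 1 -> M 1 0 = N 1 0 -> M 1 1 = N 1 1 -> M = N.
Proof. by move=> *; apply/matrixP; do 2!elim/ord2P. Qed.

Lemma mulmx22 (M N : 'M[R]_2) i j : (M * N) i j = M i 0 * N 0 j + M i 1 * N 1 j.
Proof.
rewrite mxE !big_ord_recl big_ord0 addr0; congr (_ + M i _ * N _ j);
  exact: val_inj.
Qed.

Lemma trace22 (M : 'M[R]_2) : \tr M = M 0 0 + M 1 1.
Proof.
rewrite /mxtrace !big_ord_recl big_ord0 addr0; congr (_ + M _ _);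
  exact: val_inj.
Qed.

End Matrix22.

Section Representation.
Variables (F : fieldType) (A : F).
Hypothesis A_neq0 : A != 0.

Let d : F := - A ^+ 2 - A ^- 2.

(** The pairing of the two cup diagrams on three strands: a diagram paired with itself closes a
    circle, worth [d]; distinct ones join into a single strand. *)
Definition gram : 'M[F]_2 := \matrix_(j, k) (if j == k then d else 1).

(* The action of the Temperley-Lieb generator [e_(i+1)]. *)
Definition tl_mx (i : 'I_2) : 'M[F]_2 := delta_mx i i * gram.

Definition rho_letter (x : letter) : 'M[F]_2 :=
  if x.2 then A *: 1 + A^-1 *: tl_mx x.1 else A^-1 *: 1 + A *: tl_mx x.1.

Definition rho_word (u : braid_word) : 'M[F]_2 := \prod_(x <- u) rho_letter x.

Definition rho (a : B3) := rho_word (repr a).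

Lemma tl_mx0E : tl_mx 0 = mx22 d 1 0 0.
Proof. by apply: mx22P; rewrite mulmx22 !mxE /=; ring. Qed.

Lemma tl_mx1E : tl_mx 1 = mx22 0 0 1 d.
Proof. by apply: mx22P; rewrite mulmx22 !mxE /=; ring. Qed.

Lemma rho_letterE x : rho_letter x =
  let p := if x.2 then A else A^-1 in
  let q := if x.2 then - A ^- 3 else - A ^+ 3 in
  if x.1 == 0 then mx22 q p^-1 0 p else mx22 p 0 p^-1 q.
Proof.
case: x => i []; elim/ord2P: i => /=;
  rewrite /rho_letter /= ?tl_mx0E ?tl_mx1E /d; apply: mx22P;
  rewrite !mxE /= ?invrK; field; rewrite ?A_neq0 //.
Qed.

Lemma rho_word_cat u v : rho_word (u ++ v) = rho_word u * rho_word v.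
Proof. exact: big_cat. Qed.

Lemma rho_word_eq u v : braid_eq u v -> rho_word u = rho_word v.
Proof.
elim=> {u v} [//|u v _ -> //|u v w _ -> _ //|u u' v v' _ eu _ ev|[i b]|].
- by rewrite !rho_word_cat eu ev.
- rewrite /rho_word !big_cons !big_nil mulr1 !rho_letterE /=.
  by case: (i == 0); case: b; apply: mx22P;
    rewrite /= mulmx22 !mxE /= ?invrK; field; rewrite ?A_neq0 //.
- rewrite /rho_word !big_cons !big_nil mulr1 !rho_letterE /=.
  by apply: mx22P; rewrite !mulmx22 !mxE /=; field; rewrite ?A_neq0 //.
Qed.

Lemma rho_braid_of_word u : rho (braid_of_word u) = rho_word u.
Proof. by apply/rho_word_eq/braid_of_wordP; rewrite reprB3K. Qed.

Lemma rho1 : rho 1%g = 1.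
Proof. by rewrite rho_braid_of_word [LHS]big_nil. Qed.

Lemma rhoM : {morph rho : a b / (a * b)%g >-> a * b}.
Proof.
by move=> a b; rewrite rho_braid_of_word rho_word_cat.
Qed.

Lemma rhoX a n : rho (a ^+ n)%g = rho a ^+ n.
Proof. by elim: n => [|n IHn]; rewrite ?rho1 // expgS exprS rhoM IHn. Qed.

Lemma rhoVr a : rho a * rho a^-1%g = 1.
Proof. by rewrite -rhoM mulgV rho1. Qed.

Lemma trace_rho_conj a g : \tr (rho (a ^ g)%g) = \tr (rho a).
Proof.
rewrite conjgE !rhoM [LHS]mxtrace_mulC -[LHS]/(\tr (_ * _ * _)).
by rewrite -mulrA rhoVr mulr1.
Qed.

(** The scalar is taken out to leave polynomial entries with top left entry 1. *)
Lemma rho_sigma1 : rho sigma1 = (- A ^- 3) *: mx22 1 (- A ^+ 2) 0 (- A ^+ 4).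
Proof.
rewrite rho_braid_of_word /rho_word big_seq1 rho_letterE /=.
by apply: mx22P; rewrite !mxE /=; field; rewrite ?A_neq0 //.
Qed.

Lemma rho_sigma2V : rho sigma2^-1%g = A^-1 *: mx22 1 0 (A ^+ 2) (- A ^+ 4).
Proof.
have -> : (sigma2^-1)%g = braid_of_word [:: letter_inv letter2].
  exact: B3_invE.
rewrite rho_braid_of_word /rho_word big_seq1 rho_letterE /=.
by apply: mx22P; rewrite !mxE /= ?invrK; field; rewrite ?A_neq0 //.
Qed.

Definition half_twist : B3 := (sigma1 * sigma2 * sigma1)%g.
Definition full_twist : B3 := (half_twist * half_twist)%g.

Lemma rho_full_twist : rho full_twist = (A ^- 6)%:M.
Proof.
rewrite !rhoM !rho_braid_of_word /rho_word !big_seq1 !rho_letterE /=.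
by apply: mx22P; rewrite !mulmx22 !mxE /=; field; rewrite ?A_neq0 //.
Qed.

End Representation.

(** * Traces of positive words *)

(* The number of factors [true; false], that is [ab]. *)
Fixpoint descents (w : seq bool) : nat :=
  if w is i :: w' then (i && ~~ head true w') + descents w' else 0.

Lemma descents_le w : ((descents w).*2 <= size w)%N.
Proof.
have [n] := ubnP (size w); elim: n w => // n IHn [|[] [|[] w]] //= sw;
  have := IHn w; have := IHn (true :: w); rewrite /=; lia.
Qed.

Fixpoint alternating n : seq bool :=
  if n is n'.+1 then true :: false :: alternating n' else [::].

(** Factors [ab] are disjoint, so [n] of them fill a word of length [2n]. *)
Lemma descents_max w n :
  size w = n.*2 -> descents w = n -> w = alternating n.
Proof.
elim: n w => [|n IHn] [|[] [|[] w]] //= [sw].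
- by have := descents_le (true :: w); rewrite /=; lia.
- by move=> [dw]; rewrite -(IHn w).
- by have := descents_le (true :: w); rewrite /=; lia.
- by have := descents_le w; lia.
Qed.

Lemma alternating_rcons n :
  false :: rcons (alternating n) true = rot 1 (alternating n.+1).
Proof. by elim: n => //= n; rewrite /rot /= => -[->]. Qed.

Lemma descents_rcons w : descents (rcons w true) = descents w.
Proof.
elim: w => [|i [|j w] /= IHw]; rewrite /= ?andbF //.
by rewrite IHw.
Qed.

Section Poly.
Variable R : nzRingType.

(* Up to the factors [- A^-3] and [A^-1], the images under [rho] of [sigma_1]
   and [sigma_2^-1], with ['X] for [A]. *)
Definition poly_letter (i : bool) : 'M[{poly R}]_2 :=
  if i then mx22 1 (- 'X^2) 0 (- 'X^4) else mx22 1 0 'X^2 (- 'X^4).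

Definition poly_word (w : seq bool) := \prod_(i <- w) poly_letter i.

Lemma poly_word_cons i w :
  poly_word (i :: w) = poly_letter i * poly_word w.
Proof. exact: big_cons. Qed.

(** Prepending [a] subtracts ['X^2] times the lower entry from the upper one, so the coefficient of
    degree 4 drops by one exactly when the word starts with [b]; prepending [b] gives the lower
    entry the term ['X^2]. *)
Lemma poly_word_col0 w (M := poly_word w) :
  [/\ (M 0 0)`_0 = 1, (M 1 0)`_2 = (~~ head true w)%:R
    & (M 0 0)`_4 = - (descents w)%:R].
Proof.
rewrite {}/M; elim: w => [|i w [IH0 IH2 IH4]].
  by rewrite /poly_word big_nil !mxE /= !coef1 coef0 oppr0.
rewrite poly_word_cons !mulmx22; case: i;
  rewrite !mxE /= ?(mul0r, mul1r, add0r, addr0);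
  rewrite !(coefD, coefB, coefN, mulNr, coefXnM) /= IH0 ?IH2 ?IH4.
- by rewrite oppr0 addr0 natrD opprD addrC.
- by rewrite oppr0 addr0.
Qed.

(** The entry [M 1 1] detects a factor [ab] straddling the ends of the cyclic word. For a single
    letter it is [- 'X^4], hence the condition on the size. *)
Lemma poly_word_col1 w (M := poly_word w) :
  [/\ (M 1 1)`_0 = (w == [::])%:R, (M 0 1)`_2 = - (last false w)%:R
   & (1 < size w)%N -> (M 1 1)`_4 = - (~~ head true w && last false w)%:R].
Proof.
rewrite {}/M; elim: w => [|i w [IH0 IH2 _]].
  by rewrite /poly_word big_nil !mxE /= !coef1 coef0 oppr0.
rewrite poly_word_cons !mulmx22; case: i;
  rewrite !mxE /= ?(mul0r, mul1r, add0r, addr0);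
  rewrite !(coefD, coefB, coefN, mulNr, coefXnM) /= IH0 ?IH2;
  case: w {IH0 IH2} => //= *;
  by split; rewrite ?(oppr0, subr0, sub0r).
Qed.

Lemma trace_poly_word_coef0 w :
  (\tr (poly_word w))`_0 = 1 + (w == [::])%:R.
Proof.
rewrite trace22 coefD.
by case: (poly_word_col0 w) (poly_word_col1 w) => -> _ _ [->].
Qed.

Lemma trace_poly_word_coef4 w : (1 < size w)%N ->
  (\tr (poly_word w))`_4 =
    - (descents w + (~~ head true w && last false w))%:R.
Proof.
rewrite trace22 coefD natrD opprD => sw.
by case: (poly_word_col0 w) (poly_word_col1 w) => _ _ -> [_ _ ->].
Qed.

End Poly.

(** * The bracket of a closed braid *)

Section TraceTL.
Variables (F : fieldType) (A : F).
Let d : F := - A ^+ 2 - A ^- 2.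

Definition tl_gen (o : option 'I_2) : 'M[F]_2 :=
  if o is Some i then tl_mx A i else 1.

(** [delta_mx i j * gram A] stands for the diagram with turnbacks [i] and [j] at its two ends;
    composing it with [e_k] closes a circle when [j = k]. *)
Lemma gram_tl_mx i j k :
  delta_mx i j * gram A * tl_mx A k = d ^+ (j == k) *: (delta_mx i k * gram A).
Proof.
by elim/ord2P: i; elim/ord2P: j; elim/ord2P: k; apply: mx22P;
  rewrite mulmx22 [RHS]mxE !mulmx22 !mxE /= /d; ring.
Qed.

Lemma prod_tl_gen i j os :
  delta_mx i j * gram A * \prod_(o <- os) tl_gen o =
  d ^+ stays j (pmap id os) *: (delta_mx i (last j (pmap id os)) * gram A).
Proof.
elim: os j => [|[k|] os IHos] j; rewrite ?big_nil ?big_cons /=.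
- by rewrite mulr1 scale1r.
- by rewrite mulrA gram_tl_mx -scalerAl IHos scalerA -exprD.
- by rewrite mul1r.
Qed.

(** With a turnback the exponent is the number of circles minus 1, as in the bracket. Without one
    the trace is 2 instead of [d ^+ 2], whence the correction [d ^+ 2 - 2]. *)
Lemma trace_tl os :
  \tr (\prod_(o <- os) tl_gen o) =
  if pmap id os is i :: v then d ^+ (stays i v + (last i v == i)) else 2.
Proof.
elim: os => [|[i|] os IHos]; rewrite ?big_nil ?big_cons /=.
- by rewrite mxtrace1.
- rewrite prod_tl_gen mxtraceZ exprD; congr (_ * _).
  by move: (last _ _) => l; rewrite trace22 !mulmx22 !mxE; elim/ord2P: i;
    elim/ord2P: l; rewrite /= /d; ring.
- by rewrite mul1r.
Qed.

Lemma rho_letter_split (t p : 'M[F]_2) x :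
  \tr (t * (rho_letter A x * p)) =
  (if x.2 then A else A^-1) * \tr (t * p)
  + (if x.2 then A^-1 else A) * \tr (t * tl_mx A x.1 * p).
Proof.
rewrite /rho_letter; case: x.2;
  by rewrite mulrDl mulrDr -!scalerAl -!scalerAr mul1r mxtraceD !mxtraceZ
    !mulrA.
Qed.

End TraceTL.

(** Presents the choices made in a state as a function on the crossings, as [circles_closure]
    requires. *)
Lemma uniq_unzip1_bool (T : eqType) (s : seq (T * bool)) :
  uniq (unzip1 s) -> s = [seq (k, (k, true) \in s) | k <- unzip1 s].
Proof.
elim: s => // -[k b] s IHs /= /andP[ks us]; congr (_ :: _).
  rewrite inE xpair_eqE eqxx; case: b => //=; congr (_, _).
  by apply/esym/negbTE; apply: contra ks => /(map_f fst).
rewrite {1}(IHs us); apply/eq_in_map => j js; congr (_, _).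
by rewrite inE xpair_eqE (_ : j == k = false) //; apply: contraNF ks => /eqP <-.
Qed.

(** Induction on the crossings [post] still to be smoothed, [pre] holding the choices made, latest
    first. The two terms of the bracket match those of [rho_letter]; the correction belongs to the
    only state without turnbacks, so it vanishes once a turnback is chosen. *)
Lemma bracket_rec_closure u
    (pre : seq ('I_(size u) * bool)) (post : seq 'I_(size u))
    (os := [seq turnback kh | kh <- rev pre]) :
  unzip1 (rev pre) ++ post = enum 'I_(size u) ->
  bracket_rec [seq crossing_at k | k <- post]
    (flatten [seq smoothing kh | kh <- pre] ++ arcs (braid_closure u)) =
  (delta ^+ 2 - 2) * ((pmap id os == [::])%:R *
     \prod_(k <- post) (if (letter_at k).2 then varA else varA^-1)) +
  \tr (\prod_(o <- os) tl_gen varA o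
       * \prod_(k <- post) rho_letter varA (letter_at k)).
Proof.
rewrite {}/os; elim: post pre => [|k post IHpost] pre.
  rewrite cats0 !big_nil !mulr1 => epre; rewrite trace_tl.
  have [h eh] : exists h : 'I_(size u) -> bool,
      rev pre = [seq (k, h k) | k <- enum 'I_(size u)].
    exists (fun k => (k, true) \in rev pre); rewrite -epre.
    by apply: uniq_unzip1_bool; rewrite epre enum_uniq.
  have mapE T (f : _ -> T) s :
    [seq f kh | kh <- [seq (k, h k) | k <- s]] = [seq f (k, h k) | k <- s].
    by rewrite -map_comp.
  rewrite eh -[pre]revK eh -map_rev !mapE [LHS]/= circles_closure.
  rewrite -/delta; case: pmap => [|i v] /=.
    by ring.
  by rewrite mulr0 add0r.
move=> epre; have e b : unzip1 (rev ((k, b) :: pre)) ++ post = enum 'I_(size u).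
  by rewrite rev_cons /unzip1 map_rcons cat_rcons.
have /= := IHpost _ (e true); have /= := IHpost _ (e false).
rewrite !rev_cons !map_rcons -!cats1 !pmap_cat !big_cat !big_seq1 /= cats0.
rewrite /smoothing /turnback /= /A_smoothing /B_smoothing /= !big_cons.
set p1 := \prod_(j <- post) _; set p2 := \prod_(j <- post) _.
set t := \prod_(o <- _) _; set m := pmap _ _.
have -> : (m ++ [:: (letter_at k).1] == [::]) = false by case: m.
rewrite mul0r mulr0 add0r mulr1 rho_letter_split.
move: (\tr (t * p2)) (\tr (_ * p2)) => x y.
by case: (letter_at k).2 => -> ->; ring.
Qed.

Lemma varA_neq0 : varA != 0.
Proof. by rewrite tofrac_eq0 polyX_eq0. Qed.

Lemma big_letter_at (R : Type) (idx : R) (op : R -> R -> R) u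
    (f : letter -> R) :
  \big[op/idx]_(k <- enum 'I_(size u)) f (letter_at k)
  = \big[op/idx]_(x <- u) f x.
Proof.
rewrite -(big_map (@letter_at u) xpredT f); congr bigop.
exact: (map_tnth_enum (in_tuple u)).
Qed.

Lemma bracket_closure u : bracket (braid_closure u) =
  (delta ^+ 2 - 2) * varA ^ word_expsum u + \tr (rho_word varA u).
Proof.
have := @bracket_rec_closure u [::] (enum 'I_(size u)) erefl.
rewrite /= big_nil !mul1r /bracket /= => ->.
rewrite (@big_letter_at _ _ _ u (rho_letter varA)).
rewrite (@big_letter_at _ _ _ u (fun x => if x.2 then varA else varA^-1)).
congr (_ * _ + _); rewrite /word_expsum.
elim: u => [|x u IHu]; rewrite ?big_nil ?big_cons //.
by rewrite IHu expfzDr ?varA_neq0 //; case: x.2; rewrite ?expr1z ?exprN1.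
Qed.

Lemma writhe_closure u : writhe (braid_closure u) = word_expsum u.
Proof.
rewrite /writhe big_map.
exact: (@big_letter_at _ _ _ u (fun x : letter => if x.2 then 1 else - 1)).
Qed.

Lemma jones_closure u : word_expsum u = 0 ->
  jones (braid_closure u) = delta ^+ 2 - 2 + \tr (rho varA (braid_of_word u)).
Proof.
move=> eu; rewrite /jones writhe_closure eu mulr0 expr0z mul1r.
by rewrite bracket_closure eu expr0z mulr1 (rho_braid_of_word varA_neq0).
Qed.

(** * Braids of exponent sum 0 *)

Section Classification.
Local Open Scope group_scope.

Lemma braid_ind (Q : B3 -> Prop) :
  Q 1 ->
  (forall g, Q g -> Q (sigma1 * g)) -> (forall g, Q g -> Q (sigma1^-1 * g)) ->
  (forall g, Q g -> Q (sigma2 * g)) -> (forall g, Q g -> Q (sigma2^-1 * g)) ->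
  forall g, Q g.
Proof.
move=> Q1 Qs1 Qs1V Qs2 Qs2V g; rewrite -(reprB3K g).
elim: (repr g) => [//|[i b] u IHu].
rewrite -cat1s braid_of_word_cat; elim/ord2P: i; case: b.
- exact: Qs1.
- by have := Qs1V _ IHu; rewrite [(sigma1^-1)%g]B3_invE.
- exact: Qs2.
- by have := Qs2V _ IHu; rewrite [(sigma2^-1)%g]B3_invE.
Qed.

Let y : B3 := sigma1 * sigma2.

Lemma half_twistE : half_twist = sigma2 * y.
Proof.
rewrite /half_twist /y mulgA -(braid_of_word_cat [:: letter1]).
rewrite -(braid_of_word_cat [:: letter2]) -!(braid_of_word_cat [:: _; _]).
apply/braid_of_wordP.
exact: braid_eq_braid.
Qed.

Lemma sigma1E : sigma1 = y^-1 * half_twist.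
Proof. by rewrite mulKg. Qed.

Lemma sigma2E : sigma2 = half_twist * y^-1.
Proof. by rewrite half_twistE mulgK. Qed.

Lemma sigma2VE : sigma2^-1 = y * half_twist^-1.
Proof. by rewrite sigma2E invgM invgK. Qed.

Lemma full_twistE : full_twist = y * y * y.
Proof. by rewrite /full_twist {2}half_twistE {1}/half_twist !mulgA. Qed.

(** The full twist is a power of [half_twist] and of [y], which generate the group. *)
Lemma full_twistC g : commute full_twist g.
Proof.
have zx : commute full_twist half_twist by exact: esym (mulgA _ _ _).
have zy : commute full_twist y.
  by rewrite full_twistE; move: y => h; rewrite /commute !mulgA.
have z1 : commute full_twist sigma1.
  by rewrite sigma1E; apply: commuteM => //; apply: commuteV.
have z2 : commute full_twist sigma2.
  by rewrite sigma2E; apply: commuteM => //; apply: commuteV.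
by elim/braid_ind: g => [|h|h|h|h]; [exact: commute1|..] => zh;
  apply: commuteM => //; apply: commuteV.
Qed.

Lemma braid_normal g : normal half_twist y g.
Proof.
have xy := full_twistE; have zC := full_twistC.
have nx := normal_mulx zC; have ny := normal_muly xy zC.
have nVx := normal_mulVx zC; have nVy := normal_mulVy xy zC.
elim/braid_ind: g => [|g ng|g ng|g ng|g ng]; first exact: normal1.
- by rewrite sigma1E -mulgA; auto.
- by rewrite sigma1E invgM invgK -mulgA; auto.
- by rewrite sigma2E -mulgA; auto.
- by rewrite sigma2VE -mulgA; auto.
Qed.

Lemma expsum1 : expsum 1 = 0%R.
Proof. by rewrite expsum_word /word_expsum big_nil. Qed.

Lemma expsumV g : expsum g^-1 = (- expsum g)%R.
Proof. by apply/eqP; rewrite -addr_eq0 -expsumM mulVg expsum1. Qed.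

Lemma expsumX g n : expsum (g ^+ n) = (expsum g *+ n)%R.
Proof. by elim: n => [|n IHn]; rewrite ?expsum1 // expgS expsumM IHn mulrS. Qed.

Lemma conjugate_expsum g h : conjugate g h -> expsum h = expsum g.
Proof.
by move=> [k ->]; rewrite conjgE !expsumM expsumV addrC addrK.
Qed.

Lemma expsum_full_twist : expsum full_twist = 6.
Proof. by rewrite !expsumM expsum_sigma1 expsum_sigma2. Qed.

Lemma expsum_zpower c :
  zpower full_twist c -> exists k : int, expsum c = (6 * k)%R.
Proof.
move=> [i [j ->]]; exists (i%:Z - j%:Z)%R.
by rewrite expsumM expsumV !expsumX expsum_full_twist; lia.
Qed.

Definition eval_sigma w := eval_word sigma1 sigma2^-1 w.

Lemma expsum_eval_sigma w :
  expsum (eval_sigma w) = ((count id w)%:Z - (count negb w)%:Z)%R.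
Proof.
elim: w => [|i w IHw].
  by rewrite /eval_sigma eval_nil expsum1.
rewrite /eval_sigma eval_cons expsumM -/(eval_sigma w) IHw.
by case: i => /=; rewrite ?expsumV ?expsum_sigma1 ?expsum_sigma2; lia.
Qed.

(** The exceptional classes [half_twist], [y], [y * y] have exponent sums 3, 2, 4, and central
    factors change these by multiples of 6, so 0 is never reached. *)
Lemma expsum0_conjugate g : expsum g = 0%R ->
  exists i j w, conjugate (full_twist ^+ i / full_twist ^+ j * eval_sigma w) g.
Proof.
move=> eg; have := normal_reduced full_twistE full_twistC (braid_normal g).
rewrite /reduced -sigma1E -sigma2VE => -[c [w [cz r]]].
have [k ck] := expsum_zpower cz.
case: r => [r|]; first by case: cz => i [j ec]; exists i, j, w; rewrite -ec.
by case=> [/conjugate_expsum|[]/conjugate_expsum];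
  rewrite eg !expsumM expsum_sigma1 expsum_sigma2 ck; lia.
Qed.

Lemma eval_alternating N : eval_sigma (alternating N) = beta N.
Proof.
elim: N => [|N IHN]; first by rewrite /eval_sigma eval_nil.
by rewrite /eval_sigma !eval_cons -/(eval_sigma _) IHN mulgA -expgS.
Qed.

End Classification.

(** * Traces of braids of exponent sum 0 *)

Lemma signed_power_step (F : fieldType) (A : F) (i : bool) (m n : nat) :
  (- 1) ^+ m / A ^+ (3 * m + n) * (if i then - A ^- 3 else A^-1) =
  (- 1) ^+ (i + m) / A ^+ (3 * (i + m) + (~~ i + n)).
Proof.
have ->: (3 * (i + m) + (~~ i + n) = (3 * m + n) + (if i then 3 else 1))%N.
  by case: i => /=; lia.
rewrite (exprD (-1)) (exprD A (_ + n)); move: (_ ^+ m) (_ ^+ (_ + n)) => s q.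
case: i => /=; rewrite (invfM q) mulrA; last first.
  by rewrite (expr0 (-1)) mul1r (expr1 A).
by rewrite (expr1 (-1)) mulN1r mulrN !mulNr.
Qed.

Lemma rho_eval_sigma w : rho varA (eval_sigma w) =
  ((- 1) ^+ count id w / varA ^+ (3 * count id w + count negb w))
  *: map_mx (@tofrac _) (poly_word int w).
Proof.
elim: w => [|i w IHw].
  rewrite /eval_sigma eval_nil (rho1 varA_neq0) /poly_word big_nil.
  by rewrite map_mx1 /= expr0 divr1 scale1r.
rewrite /eval_sigma eval_cons (rhoM varA_neq0) -/(eval_sigma w) IHw.
rewrite poly_word_cons map_mxM /= -scalerAr.
have -> : rho varA (if i then sigma1 else sigma2^-1%g) =
    (if i then - varA ^- 3 else varA^-1)
    *: map_mx (@tofrac _) (poly_letter int i).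
  case: i; rewrite ?(rho_sigma1 varA_neq0) ?(rho_sigma2V varA_neq0);
    congr (_ *: _); apply: mx22P; rewrite !mxE /=;
    by rewrite ?(tofrac0, tofrac1, tofracN, tofracXn).
rewrite -scalerAl scalerA; congr (_ *: _).
exact: signed_power_step.
Qed.

Lemma scalar22M (R : nzRingType) (b c : R) : b%:M * c%:M = (b * c)%:M :> 'M_2.
Proof. exact/esym/scalar_mxM. Qed.

Lemma rho_full_twistX n : rho varA (full_twist ^+ n)%g = (varA ^- (6 * n))%:M.
Proof.
rewrite (rhoX varA_neq0) (rho_full_twist varA_neq0) exprM.
rewrite -(exprVn (varA ^+ 6)); move: (varA ^- 6) => b.
elim: n => [|n IHn]; first by rewrite !expr0.
by rewrite !exprS IHn scalar22M.
Qed.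

Lemma rho_full_twistXV n :
  rho varA (full_twist ^+ n)^-1%g = (varA ^+ (6 * n))%:M.
Proof.
have := rhoVr varA_neq0 (full_twist ^+ n)%g; rewrite rho_full_twistX => e.
rewrite -[LHS]mul1r (_ : 1 = (varA ^+ (6 * n))%:M * (varA ^- (6 * n))%:M).
  by rewrite -mulrA e mulr1.
by rewrite scalar22M mulfV // expf_neq0 // varA_neq0.
Qed.

Lemma count_id_negb w : (count id w + count negb w)%N = size w.
Proof. exact: (count_predC id w). Qed.

(** For [p] letters [a] and [q] letters [b], exponent sum 0 gives [6 (i - j) = q - p], so the
    exponent [- 6 (i - j) - 3 p - q] of [varA] equals [- 2 (p + q)]. *)
Lemma trace_rho_conjugate i j w g : expsum g = 0 ->
  conjugate (full_twist ^+ i / full_twist ^+ j * eval_sigma w)%g g ->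
  (6 * i + count id w = 6 * j + count negb w)%N /\
  \tr (rho varA g) =
  (- 1) ^+ count id w / varA ^+ (2 * size w) * tofrac (\tr (poly_word int w)).
Proof.
move=> eg cg; have := conjugate_expsum cg.
rewrite eg !expsumM expsumV !expsumX expsum_full_twist expsum_eval_sigma => eij.
have {}eij : (6 * i + count id w = 6 * j + count negb w)%N by lia.
split=> //; case: cg => h ->; rewrite (trace_rho_conj varA_neq0).
rewrite !(rhoM varA_neq0) rho_full_twistX rho_full_twistXV rho_eval_sigma.
rewrite scalar22M [_ * _]mul_scalar_mx !mxtraceZ trace_map_mx.
rewrite mulrA; congr (_ * _).
have e : varA ^+ (6 * i) * varA ^+ (3 * count id w + count negb w) =
   varA ^+ (6 * j) * varA ^+ (2 * size w).
  by rewrite -!exprD -count_id_negb; congr (_ ^+ _); lia.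
have nz m : varA ^+ m != 0 by rewrite expf_neq0 // varA_neq0.
rewrite mulrCA; congr (_ * _); rewrite mulrAC -invfM e invfM mulrAC.
by rewrite mulVf ?mul1r.
Qed.

(** * Recovering a positive word from its trace *)

Lemma cross_multiply (F : fieldType) (p q s t x y : F) :
  p != 0 -> q != 0 -> s / p * x = t / q * y -> s * (q * x) = t * (p * y).
Proof.
move=> p0 q0 e; have -> : s * (q * x) = p * q * (s / p * x).
  by field; rewrite p0.
by rewrite e; field; rewrite q0.
Qed.

(** The nonzero constant terms make [m] and [k] the lowest degrees of the two sides. *)
Lemma poly_monomial_eq (p q : bool) m k (f g : {poly int}) :
  f`_0 != 0 -> g`_0 != 0 ->
  (- 1) ^+ p * ('X^m * f) = (- 1) ^+ q * ('X^k * g) ->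
  m = k /\ (f = g \/ f = - g).
Proof.
move=> f0 g0 e.
have eC (r : bool) n (h : {poly int}) l :
    ((- 1) ^+ r * ('X^n * h))`_l = (- 1) ^+ r * ('X^n * h)`_l.
  by case: r; rewrite ?expr1 ?expr0 ?mulN1r ?coefN ?mul1r.
have mk : m = k.
  case: (ltngtP m k) => // lt.
    move/(congr1 (coefp m)): e; rewrite /= !eC !coefXnM ltnn lt subnn mulr0.
    by move/eqP; rewrite mulf_eq0 signr_eq0 (negPf f0).
  move/(congr1 (coefp k)): e; rewrite /= !eC !coefXnM ltnn lt subnn mulr0.
  by move/esym/eqP; rewrite mulf_eq0 signr_eq0 (negPf g0).
split=> //; rewrite {}mk in e.
have X0 : 'X^k != 0 :> {poly int} by rewrite monic_neq0 ?monicXn.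
case: p q e => [] []; rewrite ?(mulN1r, mul1r, expr0, expr1).
- by move/oppr_inj/(mulfI X0); left.
- by rewrite -mulrN => /(mulfI X0) <-; right; rewrite opprK.
- by rewrite -mulrN => /(mulfI X0); right.
- by move/(mulfI X0); left.
Qed.

Lemma descents_alternating n : descents (alternating n) = n.
Proof. by elim: n => //= n ->. Qed.

Lemma size_alternating n : size (alternating n) = n.*2.
Proof. by elim: n => //= n ->. Qed.

Lemma count_alternating n :
  count id (alternating n) = n /\ count negb (alternating n) = n.
Proof. by elim: n => //= n [-> ->]. Qed.

(** The coefficient of degree 4 is minus the number of cyclic factors [ab]. Opposite traces would
    make this number [- N] for [w], which is negative; so it is [N], the most that length [2N]
    allows. *)
Lemma trace_poly_alternating w N : (0 < N)%N -> size w = N.*2 ->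
  \tr (poly_word int w) = \tr (poly_word int (alternating N)) \/
  \tr (poly_word int w) = - \tr (poly_word int (alternating N)) ->
  exists k, w = rot k (alternating N).
Proof.
move=> N0 sw e.
have {e} : (descents w + (~~ head true w && last false w))%N = N.
  have gt1 (v : seq bool) : size v = N.*2 -> (1 < size v)%N by move=> ->; lia.
  have := @trace_poly_word_coef4 int _ (gt1 _ sw).
  have := @trace_poly_word_coef4 int _ (gt1 _ (size_alternating N)).
  have -> : head true (alternating N) by case: N {N0 sw e gt1}.
  rewrite descents_alternating addn0.
  by case: e => ->; rewrite ?coefN => -> // /eqP; lia.
(* If a factor straddles the ends, [w] is [b v a] with [N - 1] factors in [v], of length [2N - 2];
   otherwise all [N] lie inside [w]. *)
case: (boolP (~~ _ && _)) => [/andP[]|_]; last first.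
  by rewrite addn0 => dw; exists 0%N; rewrite rot0; apply: descents_max.
case: N N0 sw => // N _; case/lastP: w => // -[|i w] j; first by case: j.
rewrite rcons_cons /= last_rcons size_rcons => -[sw].
case: i => // _; case: j => //=.
rewrite descents_rcons add0n addn1 => _ [dw]; exists 1%N.
by rewrite (descents_max sw dw); apply: alternating_rcons.
Qed.

Lemma conjugate_eval_rot k w : conjugate (eval_sigma w) (eval_sigma (rot k w)).
Proof.
rewrite -{1}(cat_take_drop k w) /rot /eval_sigma !eval_cat.
exact: conjugate_mulC.
Qed.

(* [u] is an arbitrary word for the braid [a]; it only serves to draw the
   closure of [a]. *)
Theorem theorem1p2 (N : nat) (a : B3) (u : braid_word) :
  (1 <= N)%N ->
  braid_of_word u = a ->
  expsum a = 0%R ->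
  jones (braid_closure u) = jones (braid_closure (beta_word N)) ->
  exists g : B3, a = (beta N ^ g)%g.
Proof.
move=> N0 <- {a} ea.
have [cN cN'] := count_alternating N.
have eb : expsum (beta N) = 0.
  by rewrite -eval_alternating expsum_eval_sigma cN cN' subrr.
rewrite !jones_closure -?expsum_word // ?beta_wordE // => /addrI.
have [i [j [w cw]]] := expsum0_conjugate ea.
have [eij ->] := trace_rho_conjugate ea cw.
(* [beta N] is the case of a trivial central factor. *)
have [|_ ->] := @trace_rho_conjugate 0 0 (alternating N) _ eb.
  by rewrite eval_alternating expg0 divg1 mul1g; apply: conjugate_refl.
rewrite cN size_alternating => e.
(* Clearing denominators swaps the two powers of [varA] and gives an identity between
   polynomials. *)
have {e} : (- 1) ^+ odd (count id w) * ('X^(2 * N.*2) * \tr (poly_word int w)) =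
    (- 1) ^+ odd N * ('X^(2 * size w) * \tr (poly_word int (alternating N))).
  apply/eqP; rewrite -tofrac_eq !signr_odd.
  rewrite !tofracM !tofracXn tofracN tofrac1 -/varA; apply/eqP.
  by apply: cross_multiply e; rewrite expf_neq0 // varA_neq0.
have T0 v : (\tr (poly_word int v))`_0 != 0.
  by rewrite trace_poly_word_coef0; case: (v == _).
case/poly_monomial_eq => // sw.
have {}sw : size w = N.*2 by lia.
case/(trace_poly_alternating N0 sw) => k ew.
(* Rotation preserves the letter counts, so [eij] yields [i = j] and the full twists cancel. *)
have [cw1 cw2] : count id w = N /\ count negb w = N.
  have /seq.permP c : perm_eq w (alternating N) by rewrite ew perm_rot.
  by rewrite !c.
have eij' : i = j by lia.
have [g eg] : conjugate (beta N) (braid_of_word u).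
  apply: conjugate_trans cw; rewrite eij' mulgV mul1g ew -eval_alternating.
  exact: conjugate_eval_rot.
by exists g.
Qed.
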